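(* Let $(X,b)$ be a (not necessarily connected) graph. Then $(X,b)$ is canonically compactifiable if and only if $X$ is totally bounded with respect to every pseudo metric $\sigma$ on $X$ that is intrinsic with respect to some finite measure on $X$.
   Context: A graph $G=(X,b)$ consists of a nonempty countable set $X$ (nodes) and a symmetric function $b:X\times X\to[0,\infty)$ with $b(x,x)=0$ for all $x$ and $\sum_{y\in X}b(x,y)<\infty$ for all $x\in X$. (Neither local finiteness nor connectedness is assumed.) The Dirichlet energy of $f:X\to\mathbb{C}$ is $\tilde{Q}(f)=\frac12\sum_{x,y\in X}b(x,y)|f(x)-f(y)|^2\in[0,\infty]$, and $\mathfrak{D}(G)=\{f:X\to\mathbb{C}\mid \tilde{Q}(f)<\infty\}$. The graph is canonically compactifiable if $\mathfrak{D}(G)\subseteq\ell^\infty(X)$, i.e. every function of finite energy is bounded. A pseudo metric on $X$ is a symmetric function $\sigma:X\times X\to[0,\infty)$ that vanishes on the diagonal and satisfies the triangle inequality. A measure $m$ on $X$ is a map $\mathcal{P}(X)\to[0,\infty]$ of the form $m(A)=\sum_{x\in A}m(\{x\})$ with $m(\{x\})\in(0,\infty)$ for every $x\in X$; it is finite if $m(X)<\infty$. The pseudo metric $\sigma$ is intrinsic with respect to $m$ if $\frac12\sum_{y\in X}b(x,y)\sigma(x,y)^2\le m(\{x\})$ for all $x\in X$. $X$ is totally bounded with respect to $\sigma$ if for every $\varepsilon>0$ there is a finite set $S\subseteq X$ such that $\inf_{s\in S}\sigma(x,s)<\varepsilon$ for all $x\in X$. *)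

(* Defs.v *)
From mathcomp Require Import all_boot all_order all_algebra.
From mathcomp Require Import complex.
From mathcomp Require Import all_classical all_reals all_analysis.

Set Implicit Arguments.
Unset Strict Implicit.
Unset Printing Implicit Defensive.

Import Order.TTheory GRing.Theory Num.Theory.

Local Open Scope classical_set_scope.
Local Open Scope ring_scope.

Record graph (R : realType) (X : countType) := Graph {
  weight :> X -> X -> R ;
  graph_nonempty : [set: X] !=set0 ;
  weight_ge0 : forall x y, 0 <= weight x y ;
  weight_sym : forall x y, weight x y = weight y x ;
  weight_diag : forall x, weight x x = 0 ;
  weight_summable :
    forall x, (\esum_(y in [set: X]) (weight x y)%:E < +oo)%E }.

(* [Normc.normc z : R] is the modulus; the norm [`|z|] of [R[i]] takes its
   values in [R[i]] itself. *)
Definition dirichlet_energy (R : realType) (X : countType) (b : graph R X)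
    (f : X -> R[i]) : \bar R :=
  ((2^-1)%:E * \esum_(p in [set: X * X])
     (b p.1 p.2 * Normc.normc (f p.1 - f p.2) ^+ 2)%:E)%E.

Definition finite_energy (R : realType) (X : countType) (b : graph R X) :
    set (X -> R[i]) :=
  [set f | (dirichlet_energy b f < +oo)%E].

Definition linfty (R : realType) (X : countType) : set (X -> R[i]) :=
  [set f | exists M : R, forall x, Normc.normc (f x) <= M].

Definition canonically_compactifiable (R : realType) (X : countType)
    (b : graph R X) : Prop :=
  finite_energy b `<=` @linfty R X.

Definition pseudo_metric (R : realType) (X : Type) (sigma : X -> X -> R) :
    Prop :=
  [/\ forall x y, 0 <= sigma x y,
      forall x y, sigma x y = sigma y x,
      forall x, sigma x x = 0 &
      forall x y z, sigma x z <= sigma x y + sigma y z].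

Definition full_support_measure (R : realType) (X : countType)
    (m : set X -> \bar R) : Prop :=
  (forall x, (0 < m [set x] < +oo)%E) /\
  (forall A : set X, m A = \esum_(x in A) m [set x]).

Definition finite_full_measure (R : realType) (X : countType)
    (m : set X -> \bar R) : Prop :=
  full_support_measure m /\ (m [set: X] < +oo)%E.

Definition intrinsic (R : realType) (X : countType) (b : graph R X)
    (sigma : X -> X -> R) (m : set X -> \bar R) : Prop :=
  forall x, ((2^-1)%:E * (\esum_(y in [set: X]) (b x y * sigma x y ^+ 2)%:E)
             <= m [set x])%E.

(* The infimum is taken in [\bar R], where [ereal_inf set0 = +oo]; in [R] one
   would have [inf set0 = 0], and [S = set0] would always qualify. *)
Definition totally_bounded_for (R : realType) (X : Type)
    (sigma : X -> X -> R) : Prop :=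
  forall eps : R, 0 < eps ->
    exists S : set X, finite_set S /\
      forall x, (ereal_inf [set (sigma x s)%:E | s in S] < eps%:E)%E.

(* Main.v *)
(* If f has finite energy, then sigma x y = |f x - f y| is intrinsic for a
   finite measure, and total boundedness for this sigma means that f is bounded.
   Conversely, if sigma is intrinsic for a finite m but X is not totally
   bounded, there are disjoint sigma-balls B_k of a fixed radius r; their masses
   are summable, so along a subsequence m(B_k) <= 2^-(k+1) / (k+1)^2. The sum of
   the tents (k+1) max(0, r - sigma(., z_k)) is then unbounded, while its energy
   is controlled by \sum_k (k+1)^2 m(B_k) < oo. *)
Require Import Defs.
From mathcomp Require Import all_boot all_order all_algebra.
From mathcomp Require Import complex.
From mathcomp Require Import all_classical all_reals all_analysis.
From mathcomp Require Import lra.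

Set Implicit Arguments.
Unset Strict Implicit.
Unset Printing Implicit Defensive.

Import Order.TTheory GRing.Theory Num.Theory.

Local Open Scope classical_set_scope.
Local Open Scope ring_scope.

(** * Nonnegative sums and the extraction of sequences *)

Lemma le_esumZl (R : realType) (T : choiceType) (I : set T) (r : R)
    (a : T -> \bar R) : 0 <= r -> (forall i, 0 <= a i)%E ->
  (\esum_(i in I) (r%:E * a i) <= r%:E * \esum_(i in I) a i)%E.
Proof.
move=> r0 a0; apply: ge_ereal_sup => _ [F finF <-].
rewrite -ge0_mule_fsumr// lee_wpmul2l ?lee_fin//.
by apply: esum_ge; exists F.
Qed.

Lemma esum_setXTT (R : realType) (T1 T2 : choiceType) (a : T1 -> T2 -> \bar R) :
  (forall i j, 0 <= a i j)%E ->
  \esum_(p in [set: T1 * T2]) a p.1 p.2 =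
    \esum_(i in [set: T1]) \esum_(j in [set: T2]) a i j.
Proof.
by move=> a0; rewrite esum_esum//; congr esum; apply/seteqP; split.
Qed.

(** The terms of a convergent series tend to 0, so each [d k] has a threshold past which all terms
    are at most [d k]. *)
Lemma summable_small_subseq (R : realType) (c : nat -> \bar R) (d : nat -> R) :
  (forall k, 0 <= c k)%E -> (\esum_(k in [set: nat]) c k < +oo)%E ->
  (forall k, 0 < d k) ->
  exists phi : nat -> nat, injective phi /\ forall k, (c (phi k) <= (d k)%:E)%E.
Proof.
move=> c0; rewrite -nneseries_esumT// => coo d0.
have tail k : {N | forall n, (N <= n)%N -> (c n <= (d k)%:E)%E}.
  apply: cid.
  have /fine_cvgP[fin cv] := nneseries_tail_cvg coo (fun k _ => c0 k).
  have lt : \forall N \near \oo, fine (\sum_(N <= i <oo) c i)%E < d k.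
    exact: cvgr_lt cv _ (d0 k).
  have [N _ HN] := filterI fin lt.
  exists N => n Nn; have [/= tfin tlt] := HN n Nn.
  rewrite (@le_trans _ _ (\sum_(n <= i <oo) c i)%E)//; last first.
    by rewrite -(fineK tfin) lee_fin ltW.
  apply: le_trans (@nneseries_lim_ge _ c predT n n.+1 _) => //.
  by rewrite big_nat1.
(* Adding up successors of the thresholds keeps [phi k] past the [k]-th one and makes [phi] strictly
   increasing, hence injective. *)
pose phi k := (\sum_(j < k.+1) (sval (tail j)).+1)%N.
have phi_lt : {homo phi : i j / (i < j)%N}.
  apply: homo_ltn => [y x z|i]; first exact: ltn_trans.
  by rewrite /phi [ltnRHS]big_ord_recr/= addnS ltnS leq_addr.
exists phi; split=> [i j|k].
  by case: (ltngtP i j) => // /phi_lt /[swap] ->; rewrite ltnn.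
apply: (svalP (tail k)); rewrite /phi big_ord_recr/=.
by rewrite (leq_trans (leqnSn _))// leq_addl.
Qed.

(** Greedy choice: for an [eps] at which total boundedness fails, any finite list of points leaves a
    point at distance at least [eps] from all of them. *)
Lemma separated_sequence (R : realType) (X : choiceType) (sigma : X -> X -> R) :
  pseudo_metric sigma -> ~ totally_bounded_for sigma ->
  exists eps : R, exists z : nat -> X,
    0 < eps /\ forall i j, i <> j -> eps <= sigma (z i) (z j).
Proof.
move=> [_ sC _ _] /existsNP[eps] /not_implyP[eps0 /forallNP ntb].
have next (s : seq X) : {x | forall y, y \in s -> eps <= sigma x y}.
  apply: cid; apply: contrapT => /forallNP far.
  apply: (ntb [set` s]); split => [|x]; first exact: finite_seq.
  have /existsNP[y /not_implyP[ys /negP]] := far x; rewrite -ltNge => xy.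
  by apply/ereal_inf_ltP; exists (sigma x y)%:E; [exists y | rewrite lte_fin].
(* Each choice depends on all earlier ones, so the recursion carries the list of the [n] points
   chosen before [z n]. *)
pose L := fix L n := if n is n'.+1 then sval (next (L n')) :: L n' else [::].
pose z n := sval (next (L n)).
have zL i j : (i < j)%N -> z i \in L j.
  elim: j => // j IH; rewrite ltnS leq_eqVlt => /orP[/eqP ->|/IH ij] /=.
    exact: mem_head.
  by rewrite inE ij orbT.
exists eps, z; split=> // i j; case: (ltngtP i j) => // /zL ij _.
  by rewrite sC; exact: (svalP (next (L j))).
exact: (svalP (next (L i))).
Qed.

(** * From total boundedness to compactifiability *)

Lemma normc_ge0 (R : realType) (z : R[i]) : 0 <= Normc.normc z.
Proof. by case: z => ? ?; exact: sqrtr_ge0. Qed.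

Lemma normcB_real (R : realType) (r s : R) :
  Normc.normc (r%:C%C - s%:C%C) = `|r - s|.
Proof. by rewrite -rmorphB /Normc.normc/= expr0n addr0 sqrtr_sqr. Qed.

(** [s] may vanish at some points, whereas the measure must be positive at each; adding the weights
    [2^-(pickle x + 1)], of total at most 1, repairs this. *)
Lemma exists_finite_full_measure (R : realType) (X : countType)
    (s : X -> \bar R) :
  (forall x, 0 <= s x)%E -> (\esum_(x in [set: X]) s x < +oo)%E ->
  exists m : set X -> \bar R,
    finite_full_measure m /\ forall x, (s x <= m [set x])%E.
Proof.
move=> s0 soo.
pose c (x : X) : \bar R := (1 / (2 ^ (pickle x).+1)%:R)%:E.
have c0 x : (0 < c x)%E by rewrite lte_fin divr_gt0// ltr0n expn_gt0.
have sc0 x : (0 <= s x + c x)%E by rewrite adde_ge0// ltW.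
have cfin : (\esum_(x in [set: X]) c x <= 1)%E.
  pose a n : \bar R := (1 / (2 ^ n.+1)%:R)%:E.
  have a0 n : (0 <= a n)%E by rewrite lee_fin divr_ge0.
  rewrite -(@esum_image _ _ _ setT pickle a); last first.
    by move=> x y _ _; exact: (pcan_inj pickleK).
  apply: le_trans (epsilon_trick0 xpredT (@ler01 R)).
  rewrite nneseries_esumT// esum_mkcond; apply: le_esum => n _.
  by case: ifP.
have sfin x : (s x < +oo)%E.
  apply: le_lt_trans soo; rewrite -(@esum_set1 _ _ x s)//.
  rewrite esum_mkcond; apply: le_esum => y _.
  by case: ifP.
exists (fun A => \esum_(x in A) (s x + c x))%E; split=> [|x]; last first.
  by rewrite esum_set1// leeDl// ltW.
split; last first.
  rewrite esumD// => [|x _]; last exact: ltW.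
  by rewrite lte_add_pinfty// (le_lt_trans cfin)// ltry.
split=> [x|A].
  rewrite esum_set1// lte_add_pinfty ?ltry// andbT.
  by rewrite (lt_le_trans (c0 x))// leeDr.
by apply: eq_esum => x _; rewrite esum_set1.
Qed.

(** A finite net at scale 1 suffices: [f] strays by less than 1 from its finitely many values on the
    net. *)
Lemma totally_bounded_linfty (R : realType) (X : countType) (f : X -> R[i]) :
  totally_bounded_for (fun x y => Normc.normc (f x - f y)) ->
  @linfty R X f.
Proof.
move=> /(_ 1 ltr01)[S [finS tb]].
have [M HM] : exists M : R, forall s, S s -> Normc.normc (f s) <= M.
  have /finite_seqP[r ->] := finS.
  exists (\sum_(s <- r) Normc.normc (f s)) => s rs.
  rewrite (big_rem s)//= lerDl sumr_ge0// => t _.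
  exact: normc_ge0.
exists (M + 1) => x.
have /ereal_inf_ltP[_ [s Ss <-]] := tb x; rewrite lte_fin => fxs.
rewrite -(subrKC (f s) (f x)) (le_trans (le_normcD _ _))// lerD ?HM//.
exact: ltW.
Qed.

Lemma compactifiable_of_totally_bounded (R : realType) (X : countType)
    (b : graph R X) :
  (forall sigma : X -> X -> R, pseudo_metric sigma ->
     (exists m : set X -> \bar R,
        finite_full_measure m /\ intrinsic b sigma m) ->
     totally_bounded_for sigma) ->
  canonically_compactifiable b.
Proof.
move=> tb f fE; apply: totally_bounded_linfty; apply: tb.
  split=> [x y|x y|x|x y z].
  - exact: normc_ge0.
  - by rewrite -(opprB (f y)) normcN.
  - by rewrite subrr Normc.normc0.
  - by rewrite -(subrKA (f y) (f x)); exact: le_normcD.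
set t := fun x y : X => (b x y * Normc.normc (f x - f y) ^+ 2)%:E.
have t0 x y : (0 <= t x y)%E.
  by rewrite lee_fin mulr_ge0 ?weight_ge0 ?sqr_ge0.
(* The least mass at [x] for which this [sigma] is intrinsic; its sum over [X] is the energy of
   [f]. *)
pose s x := ((2^-1)%:E * \esum_(y in [set: X]) t x y)%E.
have Et : (\esum_(x in [set: X]) \esum_(y in [set: X]) t x y < +oo)%E.
  rewrite -esum_setXTT//; move: fE; rewrite /finite_energy/= /dirichlet_energy.
  have : (0 <= \esum_(p in [set: X * X]) t p.1 p.2)%E by exact: esum_ge0.
  rewrite -/t; case: (esum _ _) => [r _ _|_|//]; first exact: ltry.
  by rewrite gt0_muley ?lte_fin ?invr_gt0.
have s_le x : (s x <= \esum_(y in [set: X]) t x y)%E.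
  rewrite -[leRHS]mul1e lee_wpmul2r ?esum_ge0// lee_fin.
  by rewrite invf_le1// ler1n.
have s0 x : (0 <= s x)%E by rewrite mule_ge0 ?lee_fin ?invr_ge0// esum_ge0.
have [m [mfin sm]] := @exists_finite_full_measure R X s s0
  (le_lt_trans (le_esum (fun x _ => s_le x)) Et).
by exists m.
Qed.

(** * From compactifiability to total boundedness *)

(* By symmetry of [b], the weight at either endpoint can be charged to the
   first one. *)
Lemma weighted_lipschitz_finite_energy (R : realType) (X : countType)
    (b : graph R X) (sigma : X -> X -> R) (m : set X -> \bar R)
    (W f : X -> R) :
  (forall x y, sigma x y = sigma y x) -> intrinsic b sigma m ->
  (forall x, 0 <= W x) ->
  (forall x y, (f x - f y) ^+ 2 <= (W x + W y) * sigma x y ^+ 2) ->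
  (\esum_(x in [set: X]) ((W x)%:E * m [set x]) < +oo)%E ->
  finite_energy b (fun x => (f x)%:C%C).
Proof.
move=> sC intr W0 lip Wm.
(* The share charged to [x]. By [intrinsic] it sums over [y] to at most [2 * W x * m [set x]], the 2
   undoing the factor 1/2. *)
pose q (x y : X) : \bar R := ((W x)%:E * (b x y * sigma x y ^+ 2)%:E)%E.
have bs0 x y : (0 <= (b x y * sigma x y ^+ 2)%:E)%E.
  by rewrite lee_fin mulr_ge0 ?weight_ge0 ?sqr_ge0.
have q0 x y : (0 <= q x y)%E by rewrite mule_ge0 ?esum_ge0 // lee_fin.
have qoo : (\esum_(p in [set: X * X]) q p.1 p.2 < +oo)%E.
  rewrite esum_setXTT//.
  have wgt x : (\esum_(y in [set: X]) q x y <= 2%:E * ((W x)%:E * m [set x]))%E.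
    apply: le_trans (le_esumZl _ (W0 x) (bs0 x)) _.
    rewrite muleCA lee_wpmul2l ?lee_fin//.
    by rewrite -lee_pdivrMl ?ltr0n//.
  apply: le_lt_trans (le_esum (fun x _ => wgt x)) _.
  have m0 x : (0 <= m [set x])%E.
    by apply: le_trans (intr x); rewrite mule_ge0 ?esum_ge0 // lee_fin invr_ge0.
  apply: le_lt_trans (le_esumZl _ _ _) _ => //.
    by move=> x; rewrite mule_ge0 ?esum_ge0 // lee_fin.
  by rewrite lte_mul_pinfty// lee_fin.
have swap : \esum_(p in [set: X * X]) q p.2 p.1 =
    \esum_(p in [set: X * X]) q p.1 p.2.
  rewrite [RHS](@reindex_esum _ _ _ setT setT (fun p => (p.2, p.1)))//.
  split=> //; first by move=> [x y] [x' y'] _ _ [-> ->].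
  by move=> [x y] _; exists (y, x).
apply: le_lt_trans (_ : _ <= (2^-1)%:E * \esum_(p in [set: X * X])
    (q p.1 p.2 + q p.2 p.1))%E _.
  rewrite lee_wpmul2l ?lee_fin ?invr_ge0//; apply: le_esum => -[x y] _.
  rewrite normcB_real real_normK ?num_real//= /q -!EFinM -EFinD lee_fin.
  rewrite (weight_sym b y) (sC y) -mulrDl [leRHS]mulrCA.
  by rewrite ler_wpM2l ?weight_ge0.
rewrite esumD// swap lte_mul_pinfty ?lee_fin ?invr_ge0//.
by rewrite lte_add_pinfty.
Qed.

Lemma totally_bounded_of_compactifiable (R : realType) (X : countType)
    (b : graph R X) (sigma : X -> X -> R) (m : set X -> \bar R) :
  canonically_compactifiable b -> pseudo_metric sigma ->
  finite_full_measure m -> intrinsic b sigma m -> totally_bounded_for sigma.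
Proof.
move=> cc pm [[m_gt0 mE] mfin] intr; apply: contrapT => ntb.
have [eps [z' [eps0 sep']]] := separated_sequence pm ntb.
have [s0 sC sxx sT] := pm.
(* Half the separation makes the open balls disjoint. *)
pose r := eps / 2.
have r0 : 0 < r by rewrite divr_gt0.
have epsE : eps = r + r by rewrite -splitr.
pose ball_at (z : nat -> X) k := [set x | sigma x (z k) < r].
have disjoint (z : nat -> X) :
    (forall i j, i <> j -> eps <= sigma (z i) (z j)) ->
    forall i j x, ball_at z i x -> ball_at z j x -> i = j.
  move=> sep i j x xi xj; apply: contrapT => /sep.
  apply/negP; rewrite -ltNge epsE.
  by rewrite (le_lt_trans (sT _ x _))// ltrD// sC.
have m0 x : (0 <= m [set x])%E by have /andP[/ltW] := m_gt0 x.
(* The squared slope [(k+1)^2] will cancel the last denominator, leaving a geometric series of sum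
   1. *)
pose d k : R := 1 / (2 ^ k.+1)%:R / k.+1%:R ^+ 2.
have d0 k : 0 < d k.
  by rewrite !divr_gt0// ?exprn_gt0 ?ltr0n// expn_gt0.
have [phi [phi_inj phi_small]] : exists phi : nat -> nat,
    injective phi /\ forall k, (m (ball_at z' (phi k)) <= (d k)%:E)%E.
  apply: (@summable_small_subseq _ (fun k => m (ball_at z' k))) => // [k|].
    by rewrite mE esum_ge0.
  (* Being disjoint, the balls have total mass at most [m [set: X]]. *)
  rewrite (eq_esum (fun k _ => mE (ball_at z' k))) -esum_bigcupT//.
    apply: le_lt_trans mfin; rewrite mE esum_mkcond.
    by apply: le_esum => x _; case: ifP.
  by move=> i j _ _ [x [xi xj]]; exact: (disjoint _ sep' _ _ x).
pose z := z' \o phi.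
pose B := ball_at z.
have sep i j : i <> j -> eps <= sigma (z i) (z j).
  by move=> ij; apply: sep' => /phi_inj.
have Bdisj := disjoint z sep.
(* By disjointness at most one tent is nonzero at [x]; selecting its index turns the sum of tents
   into a single formula. *)
pose kap x := xget 0%N [set k | B k x].
have kapE k x : B k x -> kap x = k.
  move=> Bkx; apply: (Bdisj _ _ x) => //.
  by rewrite /kap; case: xgetP => [|/(_ k)].
(* [A x] is a one-sided Lipschitz constant of [f] at [x], see [fA]. *)
pose A x : R := if `[< B (kap x) x >] then (kap x).+1%:R else 0.
(* Off the balls [kap] takes the junk value 0, but there the max vanishes. *)
pose f x : R := (kap x).+1%:R * Num.max 0 (r - sigma x (z (kap x))).
have f0 x : 0 <= f x by rewrite mulr_ge0// le_max lexx.
have A0 x : 0 <= A x by rewrite /A; case: ifP.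
have fA x y : f x - f y <= A x * sigma x y.
  rewrite /A; case: asboolP => [Bx|nBx]; last first.
    rewrite mul0r subr_le0 (le_trans _ (f0 y))// /f.
    have -> : Num.max 0 (r - sigma x (z (kap x))) = 0; last by rewrite mulr0.
    by apply/max_idPl; rewrite subr_le0 leNgt; apply/negP.
  have fxE : f x = (kap x).+1%:R * (r - sigma x (z (kap x))).
    by rewrite /f (max_idPr _)// subr_ge0 ltW.
  (* The untruncated cone of the tent at [x] lies below [f] everywhere: in its ball [f] is its
     positive part, and elsewhere it is nonpositive. *)
  have fy : (kap x).+1%:R * (r - sigma y (z (kap x))) <= f y.
    have [By|nBy] := pselect (B (kap x) y).
      by rewrite /f (kapE _ _ By) ler_wpM2l// le_max lexx orbT.
    apply: le_trans (f0 y); rewrite mulr_ge0_le0//.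
    by rewrite subr_le0 leNgt; apply/negP.
  rewrite fxE; apply: le_trans (lerB (lexx _) fy) _.
  rewrite -mulrBr ler_wpM2l// lerBlDr.
  have := sT y x (z (kap x)); rewrite (sC y x); lra.
have lip x y : (f x - f y) ^+ 2 <= (A x ^+ 2 + A y ^+ 2) * sigma x y ^+ 2.
  (* When [f y <= f x], squaring [fA] gives the bound with [A x]; the term with [A y] covers the
     opposite order. *)
  wlog xy : x y / f y <= f x.
    move=> wl; have [/wl//|/ltW/wl yx] := leP (f y) (f x).
    by rewrite -sqrrN opprB sC [A x ^+ 2 + _]addrC.
  rewrite mulrDl -!exprMn (@le_trans _ _ ((A x * sigma x y) ^+ 2))//.
    by rewrite lerXn2r// nnegrE ?subr_ge0// mulr_ge0.
  by rewrite lerDl sqr_ge0.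
have Wm0 x : (0 <= (A x ^+ 2)%:E * m [set x])%E.
  by rewrite mule_ge0// lee_fin sqr_ge0.
have Wm : (\esum_(x in [set: X]) ((A x ^+ 2)%:E * m [set x]) < +oo)%E.
  (* [A] vanishes off the balls, so the sum can be taken ball by ball, and on each ball [A] is
     constant. *)
  have -> : \esum_(x in [set: X]) ((A x ^+ 2)%:E * m [set x])%E =
      \esum_(x in \bigcup_k B k) ((A x ^+ 2)%:E * m [set x])%E.
    rewrite [RHS]esum_mkcond; apply: eq_esum => x _; case: ifPn => // /negP nx.
    rewrite /A; case: asboolP => [Bx|_]; last by rewrite expr0n mul0e.
    by case: nx; rewrite inE; exists (kap x).
  rewrite esum_bigcupT//; last first.
    by move=> i j _ _ [x [xi xj]]; exact: (Bdisj _ _ x).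
  apply: le_lt_trans (ltry 1).
  apply: le_trans (epsilon_trick0 xpredT (@ler01 R)).
  rewrite nneseries_esumT//.
  apply: le_esum => k _.
  have AE x : B k x -> A x ^+ 2 = k.+1%:R ^+ 2.
    by move=> Bx; rewrite /A (kapE _ _ Bx) asboolT.
  under eq_esum => x Bx do rewrite (AE x Bx).
  apply: le_trans (le_esumZl _ (sqr_ge0 _) m0) _.
  rewrite -mE (@le_trans _ _ ((k.+1%:R ^+ 2)%:E * (d k)%:E)%E)//.
    by rewrite lee_wpmul2l ?lee_fin ?sqr_ge0//; exact: phi_small.
  by rewrite -EFinM lee_fin /d mulrC divfK// expf_neq0// pnatr_eq0.
have /cc[M HM] : finite_energy b (fun x => (f x)%:C%C).
  apply: (weighted_lipschitz_finite_energy sC intr _ lip Wm) => x.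
  exact: sqr_ge0.
have fz k : f (z k) = k.+1%:R * r.
  have Bk : B k (z k) by rewrite /B /ball_at/= sxx.
  by rewrite /f (kapE _ _ Bk) sxx subr0 (max_idPr _)// ltW.
(* For this [n], the value [(n + 1) * r] of [f] at [z n] exceeds [M]. *)
pose n := Num.truncn (M / r).
have := HM (z n); rewrite -[_%:C%C]subr0 normcB_real subr0 fz.
apply/negP; rewrite -ltNge ger0_norm; last by rewrite mulr_ge0// ltW.
by rewrite -ltr_pdivrMr// truncnS_gt.
Qed.

Theorem corollary1 (R : realType) (X : countType) (b : graph R X) :
  canonically_compactifiable b <->
  (forall sigma : X -> X -> R,
     pseudo_metric sigma ->
     (exists m : set X -> \bar R,
        finite_full_measure m /\ intrinsic b sigma m) ->
     totally_bounded_for sigma).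
Proof.
split=> [cc sigma pm [m [mfin intr]]|].
  exact: totally_bounded_of_compactifiable cc pm mfin intr.
exact: compactifiable_of_totally_bounded.
Qed.
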